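(* Let $n$ be a positive integer and $\mathscr{H}=\{H_a(n),H_c(n)\}$. Then every connected $\mathscr{H}$-free graph $G$ satisfies $C(G)\le 4n$.
   Context: All graphs are finite, simple and undirected. A graph is $\mathscr{H}$-free if it contains no member of $\mathscr{H}$ as an induced subgraph. $H_a(n)$, the $n$-claw, is obtained from a center vertex $c$ by attaching three vertex-disjoint paths, each on $n$ vertices and each joined by one endpoint to $c$. $H_c(n)$, the $n$-net, is obtained from a triangle $t_1t_2t_3$ by attaching to each $t_j$ a pendant path on $n$ vertices, joined by one endpoint to $t_j$. $C(G)$ is the cop number of $G$ in the standard game: cops are placed first, then the robber; afterwards cops and robber alternate moves, each moving along an edge or staying put; the cop number is the minimum number of cops that can guarantee capture. *)

(* Defs.v *)
(* MathComp, with the classical axioms of mathcomp.classical.boolp. *)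
From mathcomp Require Import all_boot.
From mathcomp Require Import boolp.

Set Implicit Arguments.
Unset Strict Implicit.
Unset Printing Implicit Defensive.

Record sgraph := SGraph {
  vertex :> finType;
  edge : rel vertex;
  edge_sym : symmetric edge;
  edge_irr : irreflexive edge }.

Definition connected (G : sgraph) : Prop := forall x y : G, connect (@edge G) x y.

Definition induced_in (H G : sgraph) : Prop :=
  exists2 f : H -> G, injective f & forall x y : H, edge (f x) (f y) = edge x y.

Definition free_of (HH : sgraph -> Prop) (G : sgraph) : Prop :=
  forall H : sgraph, HH H -> ~ induced_in H G.

Definition consecutive (i j : nat) : bool := (i.+1 == j) || (j.+1 == i).

Lemma consecutiveC i j : consecutive i j = consecutive j i.
Proof. by rewrite /consecutive orbC. Qed.

Lemma consecutive_irr i : consecutive i i = false.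
Proof. by rewrite /consecutive orbb gtn_eqF. Qed.

(* [None] is the center; [Some (j, i)] is the i-th vertex of the j-th path,
   counted from 0 at the end joined to the center. *)
Definition claw_edge (n : nat) (u v : option ('I_3 * 'I_n)) : bool :=
  match u, v with
  | None, None => false
  | None, Some q => q.2 == 0 :> nat
  | Some p, None => p.2 == 0 :> nat
  | Some p, Some q => (p.1 == q.1) && consecutive p.2 q.2
  end.

Lemma claw_edge_sym n : symmetric (@claw_edge n).
Proof. by move=> [p|] [q|] //=; rewrite eq_sym consecutiveC. Qed.

Lemma claw_edge_irr n : irreflexive (@claw_edge n).
Proof. by move=> [p|] //=; rewrite consecutive_irr andbF. Qed.

Definition claw (n : nat) : sgraph :=
  SGraph (@claw_edge_sym n) (@claw_edge_irr n).

(* [(j, 0)] is the triangle vertex t_j; the [(j, i)] with 1 <= i <= n form the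
   pendant path on n vertices attached to it. *)
Definition net_edge (n : nat) (p q : 'I_3 * 'I_n.+1) : bool :=
  if p.1 == q.1 then consecutive p.2 q.2
  else (p.2 == 0 :> nat) && (q.2 == 0 :> nat).

Lemma net_edge_sym n : symmetric (@net_edge n).
Proof. by move=> p q; rewrite /net_edge eq_sym consecutiveC andbC. Qed.

Lemma net_edge_irr n : irreflexive (@net_edge n).
Proof. by move=> p; rewrite /net_edge eqxx consecutive_irr. Qed.

Definition net (n : nat) : sgraph :=
  SGraph (@net_edge_sym n) (@net_edge_irr n).

Definition legal_move (G : sgraph) (x y : G) : bool := (x == y) || edge x y.

(* A strategy maps the robber's positions so far, in chronological order, to
   the cops' positions in reply; its value at [::] is the initial placement. *)
Definition cop_strategy (k : nat) (G : sgraph) : Type :=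
  seq G -> {ffun 'I_k -> G}.

(* Legality is also required after histories that cannot occur; this is no
   restriction, since the cops may stay put there. *)
Definition legal_strategy (k : nat) (G : sgraph) (s : cop_strategy k G) : Prop :=
  forall (h : seq G) (x : G) (i : 'I_k), legal_move (s h i) (s (rcons h x) i).

Definition legal_robber (G : sgraph) (r : nat -> G) : Prop :=
  forall t : nat, legal_move (r t) (r t.+1).

(* When the robber arrives at [r t] the cops stand at [s (mkseq r t)], and they
   answer with [s (mkseq r t.+1)]. Positions after the first capture are
   irrelevant. *)
Definition captures (k : nat) (G : sgraph) (s : cop_strategy k G)
    (r : nat -> G) : Prop :=
  exists (t : nat) (i : 'I_k),
    s (mkseq r t) i = r t \/ s (mkseq r t.+1) i = r t.

Definition cops_win (k : nat) (G : sgraph) : Prop :=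
  exists2 s : cop_strategy k G, legal_strategy s &
    forall r : nat -> G, legal_robber r -> captures s r.

Lemma cops_win_exists (G : sgraph) : exists k : nat, `[< cops_win k G >].
Proof.
exists #|G|; apply/asboolP; exists (fun=> [ffun i => enum_val i]).
  by move=> h x i; rewrite /legal_move eqxx.
by move=> r _; exists 0, (enum_rank (r 0)); left; rewrite ffunE enum_rankK.
Qed.

Definition cop_number (G : sgraph) : nat := ex_minn (cops_win_exists G).

(* Main.v *)
(* Let R be the set in which the robber is confined. Maintain an induced path q
   with no vertex of N[q] in R, such that every vertex outside R adjacent to R
   has a neighbour on q. If all these boundary vertices are adjacent to the
   first or last n vertices of q, then 2n cops on the two ends of q guard R; let
   u be the boundary vertex whose first neighbour on q comes latest. Cutting q
   just after that neighbour and appending u preserves the situation and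
   shrinks R, and 3n cops suffice for the transition.
   Otherwise some boundary vertex y sees q only in its middle. Two subpaths of
   q, y and an induced path from y into R would form an n-claw or an n-net if
   that path had more than n vertices. So n further cops, starting at y and
   extending such a path in the same way, drive the robber into a smaller set
   that the old guards already close off from the rest of R. *)
Require Import Defs.
From mathcomp Require Import all_boot.
From mathcomp Require Import boolp zify.

Set Implicit Arguments.
Unset Strict Implicit.
Unset Printing Implicit Defensive.

(** * Winning positions and strategies *)

(* The cops, standing at [c], are to move. A capturing move [c'] makes the last
   premise vacuous, so capture is the base case. *)
Inductive win (k : nat) (G : sgraph) (c : {ffun 'I_k -> G}) (x : G) : Prop :=
| Win (c' : {ffun 'I_k -> G}) of (forall i, legal_move (c i) (c' i)) &
    (forall x', legal_move x x' -> (forall i, c' i <> x) -> win c' x').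

Lemma legal_move_refl (G : sgraph) (x : G) : legal_move x x.
Proof. by rewrite /legal_move eqxx. Qed.

Lemma legal_moveC (G : sgraph) (x y : G) : legal_move x y = legal_move y x.
Proof. by rewrite /legal_move eq_sym edge_sym. Qed.

(** A strategy is chosen for each first robber position, and the glued one dispatches on the head of
    the history. Outside [A] the cops stay put to remain legal. *)
Lemma strategy_after (k : nat) (G : sgraph) (c : {ffun 'I_k -> G})
    (A : G -> Prop) :
  (forall x, A x -> exists s : cop_strategy k G,
     [/\ legal_strategy s, forall i, legal_move (c i) (s [::] i) &
      forall r, legal_robber r -> r 0 = x ->
        (exists i, s [::] i = x) \/ captures s (r \o succn)]) ->
  exists s : cop_strategy k G,
    [/\ legal_strategy s, s [::] = c &
      forall r, legal_robber r -> A (r 0) -> captures s r].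
Proof.
move=> winA.
have /choice[S S_P] x : exists s : cop_strategy k G,
     [/\ legal_strategy s, forall i, legal_move (c i) (s [::] i) &
      A x -> forall r, legal_robber r -> r 0 = x ->
        (exists i, s [::] i = x) \/ captures s (r \o succn)].
  have [/winA[s [s1 s2 s3]]|nA] := pselect (A x); first by exists s.
  by exists (fun=> c); split=> [h y i|i|/nA //]; exact: legal_move_refl.
exists (fun h => if h is x :: h' then S x h' else c); split=> //.
  by move=> [|x h] y i /=; [have [_ ->] := S_P y | have [->] := S_P x].
move=> r r_legal Ar0.
have mkS t : mkseq r t.+1 = r 0 :: mkseq (r \o succn) t.
  by rewrite /mkseq /= -(addn0 1) iotaDl -map_comp.
have [_ _ /(_ Ar0 r r_legal erefl)[[i Si]|[t [i Si]]]] := S_P (r 0).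
  by exists 0, i; right.
exists t.+1, i; rewrite !mkS.
by case: Si => Si; [left|right].
Qed.

Lemma win_strategy (k : nat) (G : sgraph) (c : {ffun 'I_k -> G}) (x : G) :
  win c x -> exists s : cop_strategy k G,
     [/\ legal_strategy s, forall i, legal_move (c i) (s [::] i) &
      forall r, legal_robber r -> r 0 = x ->
        (exists i, s [::] i = x) \/ captures s (r \o succn)].
Proof.
elim=> {c x} c x c' cc' _ IH.
have [|s [s_legal s0 sA]] := @strategy_after k G c'
    (fun x' => legal_move x x' /\ forall i, c' i <> x).
  by move=> x' [xx' c'x]; exact: IH.
exists s; split=> // [i|r r_legal r0]; first by rewrite s0.
have [|free] := pselect (exists i, s [::] i = x); first by left.
right; apply: sA; first by move=> t; exact: r_legal.
split; first by rewrite /= -r0; exact: r_legal.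
by move=> i c'i; apply: free; exists i; rewrite s0.
Qed.

Lemma cops_win_win (k : nat) (G : sgraph) (c : {ffun 'I_k -> G}) :
  (forall x, win c x) -> cops_win k G.
Proof.
move=> winc.
have [|s [s_legal _ sP]] := @strategy_after k G c (fun=> True).
  by move=> x _; exact: win_strategy.
by exists s => // r r_legal; exact: sP.
Qed.

Lemma win_capture (k : nat) (G : sgraph) (c : {ffun 'I_k -> G}) (x : G)
  (i : 'I_k) : legal_move (c i) x -> win c x.
Proof.
move=> cix; apply: (@Win _ _ _ _ [ffun j => if j == i then x else c j]).
  by move=> j; rewrite ffunE; case: eqP => [->|_] //; exact: legal_move_refl.
by move=> x' _ /(_ i); rewrite ffunE eqxx.
Qed.

(** * Guarded territories and the walk of one cop *)

Definition wins_on (k : nat) (G : sgraph) (D : seq G) (R : {set G}) : Prop :=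
  forall (c : {ffun 'I_k -> G}) x,
    {subset D <= codom c} -> x \in R -> win c x.

Definition guards (G : sgraph) (D : seq G) (R : {set G}) : Prop :=
  forall x y, x \in R -> y \notin R -> edge x y -> has (@legal_move G ^~ y) D.

Definition far (G : sgraph) (D : seq G) (R : {set G}) : Prop :=
  forall v x, v \in D -> x \in R -> ~~ legal_move v x.

Definition away (G : sgraph) (R : {set G}) (w : G) : {set G} :=
  [set x in R | ~~ legal_move w x].

Lemma wins_on_sub (k : nat) (G : sgraph) (D D' : seq G) (R : {set G}) :
  {subset D' <= D} -> wins_on k D' R -> wins_on k D R.
Proof. by move=> D'D win' c x Dc; apply: win' => v /D'D /Dc. Qed.

(** Pigeonhole: covering [D] takes at most [size D] of the [k] cops. *)
Lemma free_cop (k : nat) (G : sgraph) (c : {ffun 'I_k -> G}) (D : seq G) :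
  size D < k -> {subset D <= codom c} ->
  exists j, forall v, v \in D -> exists2 i, i != j & c i = v.
Proof.
move=> D_lt Dc.
have [f fP] : exists f : G -> 'I_k, forall v, v \in D -> c (f v) = v.
  have k_gt0 : 0 < k by lia.
  exists (fun v => odflt (Ordinal k_gt0) [pick i | c i == v]) => v /Dc.
  case/codomP=> i ->; case: pickP => [j /eqP //|/(_ i)]; by rewrite eqxx.
have [j jD] : exists j, j \notin map f D.
  apply/existsP; apply: contraLR D_lt; rewrite negb_exists -leqNgt => /forallP h.
  rewrite -(size_map f); apply: leq_trans (eq_leq (esym (card_ord k))) _.
  apply: leq_trans (card_size _).
  by apply/subset_leq_card/subsetP=> j _; have:= h j; rewrite negbK.
exists j => v vD; exists (f v); last exact: fP.
by apply: contraNneq jD => <-; exact: map_f.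
Qed.

(** The spare cop walks to [w] while the others stand still. A robber leaving [R] comes within reach
    of a guard and is caught; one within reach of [w] is caught on arrival. *)
Lemma wins_on_advance (k : nat) (G : sgraph) (w : G) (D : seq G) (R : {set G}) :
  connected G -> size D < k -> guards D R ->
  wins_on k (w :: D) (away R w) -> wins_on k D R.
Proof.
move=> G_conn D_lt D_guards winw c x Dc.
have [j jP] := free_cop D_lt Dc.
have [s] := connectP (G_conn (c j) w).
elim: s c x jP {Dc} => [|z s IH] c x jP /=.
  move=> _ wE xR; have [wx|nwx] := boolP (legal_move w x).
    by apply: (@win_capture _ _ _ _ j); rewrite -wE.
  apply: winw; last by rewrite inE xR.
  move=> v; rewrite inE => /predU1P[->|/jP[i _ <-]]; last exact: codom_f.
  by rewrite wE codom_f.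
case/andP=> cjz zs wE xR.
pose c' : {ffun 'I_k -> G} := [ffun i => if i == j then z else c i].
have c'P v : v \in D -> exists2 i, i != j & c' i = v.
  by move=> /jP[i ij civ]; exists i; rewrite // ffunE (negbTE ij).
apply: (@Win _ _ _ _ c') => [i|x' xx' _].
  rewrite ffunE; case: eqP => [->|_]; last exact: legal_move_refl.
  by rewrite /legal_move cjz orbT.
have [x'R|x'R] := boolP (x' \in R).
  by apply: IH; rewrite // ffunE eqxx.
have xx'e : edge x x'.
  by case/orP: xx' => // /eqP xE; rewrite -xE xR in x'R.
have /hasP[v vD vx'] := D_guards _ _ xR x'R xx'e.
have [i _ c'i] := c'P _ vD.
by apply: (@win_capture _ _ _ _ i); rewrite c'i.
Qed.

(** * Induced paths and the forbidden patterns *)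

Definition ipath (G : sgraph) (p : seq G) : Prop :=
  uniq p /\ forall v i j, i < size p -> j < size p ->
    edge (nth v p i) (nth v p j) = consecutive i j.

(** The cut comes right after the latest first neighbour, so [w] sees only the last vertex kept,
    while every vertex of [B] keeps its first neighbour. *)
Lemma ipath_extend (G : sgraph) (p : seq G) (B : {set G}) :
  ipath p -> B != set0 ->
  (forall y, y \in B -> y \notin p /\ has (edge y) p) ->
  exists2 w, w \in B & exists p', [/\ ipath (rcons p' w), p' != [::],
    prefix p' p & forall y, y \in B -> has (edge y) p'].
Proof.
move=> [p_uniq p_edge] /set0Pn[y0 y0B] BP.
have [w wB wmax] := arg_maxnP (fun y => find (edge y) p) y0B.
have [wp hw] := BP _ wB.
set a := find (edge w) p in wmax.
have a_lt : a < size p by rewrite -has_find.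
have size_take : size (take a.+1 p) = a.+1 by apply: size_takel.
exists w => //; exists (take a.+1 p); split.
- split.
    rewrite rcons_uniq (take_uniq _ p_uniq) andbT.
    by apply: contra wp => /mem_take.
  rewrite size_rcons size_take.
  have aux v i : i <= a -> edge w (nth v p i) = (i == a).
    move=> ia; have [->|ne] := eqVneq i a; first exact: nth_find.
    by apply: before_find; rewrite -/a; lia.
  move=> v i j iL jL; rewrite !nth_rcons size_take.
  have [ia|ia] := ltnP i a.+1; have [ja|ja] := ltnP j a.+1.
  + by rewrite !nth_take // p_edge //; lia.
  + have -> : j = a.+1 by lia.
    by rewrite eqxx nth_take // edge_sym aux // /consecutive; lia.
  + have -> : i = a.+1 by lia.
    by rewrite eqxx nth_take // aux // /consecutive; lia.
  + have -> : i = a.+1 by lia.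
    have -> : j = a.+1 by lia.
    by rewrite eqxx edge_irr consecutive_irr.
- by rewrite -size_eq0 size_take.
- exact: prefix_take.
- move=> y yB; have [_ hy] := BP _ yB.
  apply/hasP; exists (nth y p (find (edge y) p)); last exact: nth_find.
  have := wmax _ yB; rewrite -/a => le.
  rewrite -(@nth_take a.+1) //; apply: mem_nth; rewrite size_take; lia.
Qed.

Ltac arith :=
  repeat match goal with
  | H : ?T |- _ =>
    lazymatch type of T with
    | Prop => lazymatch T with
              | is_true (leq _ _) => fail
              | @eq nat _ _ => fail
              | _ => clear H
              end
    | _ => clear H
    end
  end;
  repeat match goal with x := _ |- _ => clearbody x end;
  do ?case: ifPn => ?; lia.

(** Two arms run outwards along [q] from the first and last neighbours of [y], long enough because
    [y] misses both ends; the third runs along [y :: p]. The gap between these neighbours decides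
    between claw and net. *)
Lemma ipath_short (n : nat) (G : sgraph) (q : seq G) (y : G) (p : seq G) :
  0 < n -> free_of (fun H : sgraph => H = claw n \/ H = net n) G ->
  ipath q -> ipath (y :: p) -> has (edge y) q ->
  (forall v, v \in take n q ++ drop (size q - n) q -> ~~ legal_move v y) ->
  y \notin q -> (forall v x, v \in q -> x \in p -> ~~ legal_move v x) ->
  size (y :: p) <= n.
Proof.
move=> n_gt0 G_free [q_uniq q_edge] [p_uniq p_edge] yq y_ends yNq p_far.
rewrite leqNgt; apply/negP => n_lt.
set m := size q in y_ends.
pose e i := edge y (nth y q i).
have e_ends i : i < m -> e i -> n <= i /\ i + n < m.
  move=> im ei.
  have ends v : v \in take n q ++ drop (m - n) q -> ~~ edge y v.
    by move/y_ends; rewrite legal_moveC negb_or => /andP[].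
  split; rewrite leqNgt; apply/negP => i_end.
    apply: (negP _ ei); apply: ends; rewrite mem_cat; apply/orP; left.
    rewrite -(@nth_take n) // mem_nth //.
    by rewrite size_take -/m; case: ifP; lia.
  apply: (negP _ ei); apply: ends; rewrite mem_cat; apply/orP; right.
  have -> : i = m - n + (i - (m - n)) by lia.
  by rewrite -nth_drop mem_nth // size_drop -/m; lia.
(* [q_a] and [q_b] are the first and last neighbours of [y] on [q]. *)
pose P i := (i < m) && e i.
have exP : exists i, P i.
  exists (find (edge y) q); rewrite /P /m -has_find yq.
  exact: nth_find.
have Pm i : P i -> i <= m by case/andP=> /ltnW.
case: (ex_minnP exP) => a /andP[am ea] a_min.
case: (ex_maxnP exP Pm) => b /andP[bm eb] b_max.
have ab : a <= b by apply: a_min; rewrite /P bm.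
have [na _] := e_ends _ am ea.
have [_ bn] := e_ends _ bm eb.
have eE i : i < m -> (i <= a) || (b <= i) -> e i = (i == a) || (i == b).
  move=> im iab; apply/idP/orP => [ei|[/eqP->|/eqP->] //].
  have Pi : P i by rewrite /P im.
  by have := a_min _ Pi; have := b_max _ Pi; lia.
(* The pattern is embedded through positions in [s], with [y] at position [m]. *)
pose s := q ++ y :: p.
have s_uniq : uniq s.
  rewrite cat_uniq q_uniq p_uniq andbT /=; apply/norP; split=> //.
  apply/hasPn => x xp; apply/negP => xq.
  by have := p_far _ _ xq xp; rewrite legal_move_refl.
(* [A] is adjacency read off positions, so that the patterns can be checked by arithmetic. [good]
   drops the stretch strictly between [a] and [b], where [y] may have further neighbours. *)
pose A i j :=
  if i < m then
    if j < m then consecutive i j else (j == m) && ((i == a) || (i == b))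
  else
    if j < m then (i == m) && ((j == a) || (j == b)) else consecutive i j.
pose good i := (i < m + n.+1) && ((i <= a) || (b <= i)).
have s_edge i j : good i -> good j -> edge (nth y s i) (nth y s j) = A i j.
  have cross i' j' : good i' -> i' < m -> m <= j' < m + n.+1 ->
      edge (nth y s i') (nth y s j') = (j' == m) && ((i' == a) || (i' == b)).
    move=> /andP[_ iab] im /andP[mj jn]; rewrite /s !nth_cat -/m im ltnNge mj /=.
    have [->|jm] := eqVneq j' m; first by rewrite subnn /= edge_sym -eE.
    have -> : j' - m = (j' - m).-1.+1 by lia.
    have : ~~ legal_move (nth y q i') (nth y p (j' - m).-1).
      by apply: p_far; apply: mem_nth => //; move: n_lt => /=; lia.
    by rewrite /= negb_or => /andP[_ /negbTE].
  move=> gi gj; rewrite /A.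
  have [/andP[i_lt _] /andP[j_lt _]] := (gi, gj).
  have [im|im] := ltnP i m; have [jm|jm] := ltnP j m => /=.
  - by rewrite /s !nth_cat -/m im jm q_edge.
  - by rewrite cross // jm.
  - by rewrite edge_sym cross // im.
  - rewrite /s !nth_cat -/m !ltnNge im jm /= p_edge /consecutive;
      move: n_lt => /= n_lt; arith.
have s_size : m + n.+1 <= size s by rewrite size_cat -/m; lia.
have embed (H : sgraph) (f : H -> nat) : H = claw n \/ H = net n ->
    (forall u, good (f u)) -> injective f ->
    (forall u v, A (f u) (f v) = edge u v) -> False.
  move=> HH f_good f_inj f_edge; apply: (G_free H HH).
  exists (fun u => nth y s (f u)); last by move=> u v; rewrite s_edge.
  have f_lt u : f u < size s by have := f_good u; rewrite /good; lia.
  by move=> u v /eqP; rewrite nth_uniq // => /eqP /f_inj.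
have ordE k (i j : 'I_k) : (i == j) = (i == j :> nat) by [].
have leg (i : 'I_3) : [\/ i = 0 :> nat, i = 1 :> nat | i = 2 :> nat].
  case: i => -[|[|[|]]] //= _; by [constructor 1|constructor 2|constructor 3].
have [b_a|[b_a|b_a]] : b = a \/ b = a.+1 \/ a.+1 < b by lia.
- (* The center is [q_a], the only neighbour of [y] on [q]. *)
  pose f (u : claw n) : nat := match u with
    | None => a
    | Some (j, i) => if j == 0 :> nat then a - i.+1
                     else if j == 1 :> nat then a + i.+1 else m + i end.
  apply: (@embed _ f); first by left.
  + case=> [[j i]|] /=; rewrite /good; last lia.
    by have i_lt := ltn_ord i; case: (leg j) => -> /=; arith.
  + case=> [[j i]|] [[j' i']|] //= fE.
    * have i_lt := ltn_ord i; have i'_lt := ltn_ord i'.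
      have [E1 E2] : j = j' :> nat /\ i = i' :> nat.
        by move: fE; case: (leg j) (leg j') => -> [] -> /=; arith.
      by congr (Some (_, _)); apply: val_inj.
    * have i_lt := ltn_ord i.
      by move: fE; case: (leg j) => -> /=; arith.
    * have i_lt := ltn_ord i'.
      by move: fE; case: (leg j') => -> /=; arith.
  + case=> [[j i]|] [[j' i']|] //=; rewrite ?ordE /A /consecutive.
    * have i_lt := ltn_ord i; have i'_lt := ltn_ord i'.
      by case: (leg j) (leg j') => -> [] -> /=; arith.
    * have i_lt := ltn_ord i; by case: (leg j) => -> /=; arith.
    * have i_lt := ltn_ord i'; by case: (leg j') => -> /=; arith.
    * arith.
- (* The triangle is [q_a], [q_b], [y]. *)
  pose f (u : net n) : nat :=
    if u.1 == 0 :> nat then a - u.2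
    else if u.1 == 1 :> nat then b + u.2 else m + u.2.
  apply: (@embed _ f); first by right.
  + case=> j i; rewrite /good /f /=.
    by have i_lt := ltn_ord i; case: (leg j) => -> /=; arith.
  + case=> j i [j' i']; rewrite /f /= => fE.
    have i_lt := ltn_ord i; have i'_lt := ltn_ord i'.
    have [E1 E2] : j = j' :> nat /\ i = i' :> nat.
      by move: fE; case: (leg j) (leg j') => -> [] -> /=; arith.
    by congr (_, _); apply: val_inj.
  + case=> j i [j' i']; rewrite /f /= /net_edge /= ordE /A /consecutive.
    have i_lt := ltn_ord i; have i'_lt := ltn_ord i'.
    by case: (leg j) (leg j') => -> [] -> /=; arith.
- (* The center is [y]; its other neighbours on [q] lie strictly between [q_a]
     and [q_b] and are not used. *)
  pose f (u : claw n) : nat := match u with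
    | None => m
    | Some (j, i) => if j == 0 :> nat then a - i
                     else if j == 1 :> nat then b + i else m + i.+1 end.
  apply: (@embed _ f); first by left.
  + case=> [[j i]|] /=; rewrite /good; last lia.
    by have i_lt := ltn_ord i; case: (leg j) => -> /=; arith.
  + case=> [[j i]|] [[j' i']|] //= fE.
    * have i_lt := ltn_ord i; have i'_lt := ltn_ord i'.
      have [E1 E2] : j = j' :> nat /\ i = i' :> nat.
        by move: fE; case: (leg j) (leg j') => -> [] -> /=; arith.
      by congr (Some (_, _)); apply: val_inj.
    * have i_lt := ltn_ord i.
      by move: fE; case: (leg j) => -> /=; arith.
    * have i_lt := ltn_ord i'.
      by move: fE; case: (leg j') => -> /=; arith.
  + case=> [[j i]|] [[j' i']|] //=; rewrite ?ordE /A /consecutive.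
    * have i_lt := ltn_ord i; have i'_lt := ltn_ord i'.
      by case: (leg j) (leg j') => -> [] -> /=; arith.
    * have i_lt := ltn_ord i; by case: (leg j) => -> /=; arith.
    * have i_lt := ltn_ord i'; by case: (leg j') => -> /=; arith.
    * arith.
Qed.

(** * Shrinking the territory *)

Lemma awayP (G : sgraph) (R : {set G}) (w x : G) :
  reflect (x \in R /\ ~~ legal_move w x) (x \in away R w).
Proof. by rewrite inE; apply: andP. Qed.

Lemma away_proper (G : sgraph) (R : {set G}) (w x : G) :
  x \in R -> edge x w -> away R w \proper R.
Proof.
move=> xR xw; apply/properP; split; first by apply/subsetP=> z /awayP[].
by exists x => //; apply/awayP => -[_]; rewrite /legal_move edge_sym xw orbT.
Qed.

Lemma away_boundary (G : sgraph) (R : {set G}) (w z : G) :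
  w \notin R -> z \in R -> z \notin away R w -> edge z w.
Proof.
move=> wR zR; rewrite inE zR negbK /legal_move edge_sym => /predU1P[wz|//].
by rewrite wz zR in wR.
Qed.

Lemma mem_prefix (T : eqType) (s t : seq T) : prefix s t -> {subset s <= t}.
Proof. by case/prefixP=> r -> x xs; rewrite mem_cat xs. Qed.

Lemma has_edge_legal (G : sgraph) (p : seq G) (z : G) :
  has (edge z) p -> has (@legal_move G ^~ z) p.
Proof. by apply: sub_has => v zv; rewrite /legal_move edge_sym zv orbT. Qed.

Lemma far_adjacent (G : sgraph) (p : seq G) (R : {set G}) (x z : G) :
  far p R -> x \in R -> edge x z -> z \notin p.
Proof.
move=> p_far xR xz; apply/negP => zp.
by have := p_far _ _ zp xR; rewrite /legal_move edge_sym xz orbT.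
Qed.

(** The cops for [T] walk in one by one while [D] confines the robber; the shrinking of [R] along
    the way is ignored. *)
Lemma wins_on_place (k : nat) (G : sgraph) (T D : seq G) (R : {set G}) :
  connected G -> size T + size D <= k -> guards D R ->
  wins_on k (T ++ D) R -> wins_on k D R.
Proof.
move=> G_conn; elim: T D => [|w T IH] D //= le D_guards winT.
apply: (@wins_on_advance _ _ w) => //; first by lia.
move=> c x Dc /awayP[xR _]; apply: (IH (w :: D)) => //=; first by lia.
  by move=> a b aR bR ab; rewrite /= (D_guards a b) // orbT.
by apply: wins_on_sub winT => v; rewrite !(inE, mem_cat) => /or3P[] ->; rewrite ?orbT.
Qed.

(* [R0] is the territory closed off by [E] when [y] was chosen. The induction
   stops when no neighbour of [R] is left in [R0], which is when the cops on the
   path become superfluous. *)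
Lemma wins_on_growing (k n : nat) (G : sgraph) (E : seq G) (R0 : {set G})
    (y : G) :
  connected G -> guards E R0 -> size E + n <= k ->
  (forall R : {set G}, R \proper R0 ->
     (forall x z, x \in R -> z \notin R -> edge x z -> z \notin R0) ->
     wins_on k E R) ->
  (forall p, ipath (y :: p) -> {subset p <= R0} -> size (y :: p) <= n) ->
  forall (R : {set G}) p, R \proper R0 -> ipath (y :: p) -> {subset p <= R0} ->
    far (y :: p) R ->
    (forall x z, x \in R -> z \in R0 -> z \notin R -> edge x z ->
       has (edge z) (y :: p)) ->
  wins_on k (E ++ y :: p) R.
Proof.
move=> G_conn E_guards E_size win_below p_short R.
have [r] := ubnP #|R|; elim: r R => // r IH R R_lt p RR0 p_path pR0 p_far p_bnd.
pose B := [set z in R0 | (z \notin R) && [exists x in R, edge x z]].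
have BP x z : x \in R -> z \in R0 -> z \notin R -> edge x z -> z \in B.
  move=> xR zR0 zR xz; rewrite inE zR0 zR /=.
  by apply/existsP; exists x; rewrite xR.
have [B0|Bn0] := eqVneq B set0.
  apply: (@wins_on_sub _ _ _ E); first by move=> v vE; rewrite mem_cat vE.
  apply: win_below => // x z xR zR xz; apply/negP => zR0.
  by have := BP _ _ xR zR0 zR xz; rewrite B0 inE.
have [|w] := ipath_extend p_path Bn0.
  move=> z; rewrite inE => /and3P[zR0 zR /exists_inP[x xR xz]].
  by split; [exact: far_adjacent p_far xR xz | exact: (p_bnd x)].
(* The kept prefix is nonempty, so the new path still starts at [y]. *)
rewrite inE => /and3P[wR0 wR /exists_inP[x xR xw]] [[|y' p'] [] //].
rewrite rcons_cons prefix_cons => p'_path _ /andP[/eqP y'E p'p] B_adj.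
subst y'.
have p'R0 : {subset rcons p' w <= R0}.
  by move=> v; rewrite mem_rcons inE => /predU1P[->//|/(mem_prefix p'p)/pR0].
have sub_p' : {subset y :: p' <= y :: p}.
  move=> v; rewrite !inE => /predU1P[->|/(mem_prefix p'p) ->].
    by rewrite eqxx.
  by rewrite orbT.
(* With [w] the path has at most [n] vertices, so without it a cop is left to walk to [w]. *)
have := p_short _ p'_path p'R0; rewrite /= size_rcons => p'_size.
apply: (@wins_on_sub _ _ _ (E ++ y :: p')).
  by move=> v; rewrite !mem_cat => /orP[->//|/sub_p' ->]; rewrite orbT.
apply: (@wins_on_advance _ _ w) => //.
- by rewrite size_cat /=; lia.
- move=> a z aR zR az; rewrite has_cat; have [zR0|zR0] := boolP (z \in R0).
    by rewrite (has_edge_legal (B_adj z (BP a z aR zR0 zR az))) orbT.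
  by rewrite (E_guards a z) // (subsetP (proper_sub RR0)).
- apply: (@wins_on_sub _ _ _ (E ++ y :: rcons p' w)).
    move=> v; rewrite !(inE, mem_cat, mem_rcons).
    by case/or4P=> ->; rewrite ?orbT.
  have wRp := away_proper xR xw.
  apply: IH => //.
  + by apply: leq_trans (proper_card wRp) _; lia.
  + exact: proper_trans RR0.
  + move=> v a; rewrite -rcons_cons mem_rcons in_cons => vp /awayP[aR wa].
    by case/predU1P: vp => [->//|/sub_p'/p_far->].
  + move=> a z /awayP[aR wa] zR0 zR az; rewrite -rcons_cons has_rcons.
    have [zR'|zR'] := boolP (z \in R); first by rewrite (away_boundary wR zR' zR).
    by rewrite (B_adj _ (BP a z aR zR0 zR' az)) orbT.
Qed.

(** The two pieces overlap on a short path; the size is at most [2 * n] in any case. *)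
Definition ends (G : sgraph) (n : nat) (q : seq G) : seq G :=
  take n q ++ drop (size q - n) q.

(** Without boundary, [R] would be closed under adjacency and contain all of the connected graph. *)
Lemma boundary_neq0 (G : sgraph) (R : {set G}) (v x : G) :
  connected G -> v \notin R -> x \in R ->
  [set z | (z \notin R) && [exists x in R, edge x z]] != set0.
Proof.
move=> G_conn vR xR; apply/negP => /eqP B0.
have R_closed : closed (@edge G) (mem R).
  apply: intro_closed => [|a z az aR]; first exact: sym_connect_sym (@edge_sym G).
  apply: contraT => zR; suff : z \in set0 by rewrite inE.
  by rewrite -B0 inE zR; apply/existsP; exists a; rewrite aR.
by have := closed_connect R_closed (G_conn x v); rewrite /= xR (negbTE vR).
Qed.

(** Induction on the size of [R]. [E] may exceed the ends of [q], because just after an extension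
    the guards of the previous path are still in place. *)
Lemma wins_on_ends (n : nat) (G : sgraph) :
  0 < n -> connected G ->
  free_of (fun H : sgraph => H = claw n \/ H = net n) G ->
  forall (R : {set G}) q E, ipath q -> q != [::] -> far q R -> guards E R ->
    (forall x z, x \in R -> z \notin R -> edge x z -> has (edge z) q) ->
    {subset ends n q <= E} -> size E <= 3 * n ->
  wins_on (4 * n) E R.
Proof.
move=> n_gt0 G_conn G_free R.
have [r] := ubnP #|R|.
elim: r R => // r IH R R_lt q E q_path q_n0 q_far E_guards q_bnd qE E_size.
have [->|[x0 x0R]] := set_0Vmem R; first by move=> c x _; rewrite inE.
pose B := [set z | (z \notin R) && [exists x in R, edge x z]].
have BP x z : x \in R -> z \notin R -> edge x z -> z \in B.
  by move=> xR zR xz; rewrite inE zR; apply/existsP; exists x; rewrite xR.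
have Bn0 : B != set0.
  case: q q_n0 q_far {q_path q_bnd qE} => // v q _ q_far.
  apply: (boundary_neq0 (v := v)) x0R => //; apply/negP => vR.
  by have := q_far v v (mem_head _ _) vR; rewrite legal_move_refl.
have Bq z : z \in B -> z \notin q /\ has (edge z) q.
  rewrite inE => /andP[zR /exists_inP[x xR xz]].
  by split; [exact: far_adjacent q_far xR xz | exact: (q_bnd x)].
have [/exists_inP[y yB y_mid]|] :=
  boolP [exists y in B, ~~ has (@legal_move G ^~ y) (ends n q)].
  have [yq yq_edge] := Bq _ yB.
  move: yB; rewrite inE => /andP[yR /exists_inP[x xR xy]].
  have yRp := away_proper xR xy.
  apply: (@wins_on_advance _ _ y) => //; first by arith.
  apply: (@wins_on_sub _ _ _ (E ++ [:: y])).
    by move=> v; rewrite mem_cat !inE orbC.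
  apply: (@wins_on_growing _ n _ _ R) => //; first by arith.
  (* Every exit of [R1] is already an exit of [R], so the same [q] and [E] serve for the smaller
     territory. *)
  - move=> R1 R1R R1_bnd.
    have R1sub := subsetP (proper_sub R1R).
    apply: (IH _ _ q) => //.
    + by apply: leq_trans (proper_card R1R) _; arith.
    + by move=> v a vq /R1sub; exact: q_far.
    + move=> a z aR1 zR1 az.
      by apply: (E_guards a z); [exact: R1sub | exact: (R1_bnd a) |].
    + move=> a z aR1 zR1 az.
      by apply: (q_bnd a z); [exact: R1sub | exact: (R1_bnd a) |].
  (* The path lies in [R] and hence far from [q], so the forbidden patterns bound its length. *)
  - move=> p p_path pR; apply: (ipath_short n_gt0 G_free q_path) => //.
      by move=> v v_end; move/hasPn: y_mid; exact.
    by move=> v z vq /pR; exact: q_far.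
  - by split=> // v [] // [] // _ _; rewrite /= edge_irr consecutive_irr.
  - by move=> v a; rewrite inE => /eqP-> /awayP[].
  - by move=> a z _ zR zR' _; rewrite /= (away_boundary yR zR zR').
rewrite negb_exists => /forallP ends_B.
have ends_guards : guards (ends n q) R.
  move=> x z xR zR xz; have := ends_B z.
  by rewrite (BP x z) //= negbK.
have [u uB [p [p_path p_n0 pq B_adj]]] := ipath_extend q_path Bn0 Bq.
move: uB; rewrite inE => /andP[uR /exists_inP[x xR xu]].
have uRp := away_proper xR xu.
(* [T] and [u] make up the last [n] vertices of the new path; with the old ends this is at most
   [(n - 1) + 1 + 2 * n] cops. *)
pose T := drop (size p - n.-1) p.
have T_size : size T <= n.-1 by rewrite size_drop; arith.
have ends_size : size (ends n q) <= 2 * n.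
  by rewrite size_cat size_take size_drop; arith.
apply: (wins_on_sub qE).
apply: (@wins_on_place _ _ T) => //; first by arith.
apply: (@wins_on_advance _ _ u) => //.
- by rewrite size_cat; arith.
- by move=> a z aR zR az; rewrite has_cat (ends_guards a z) // orbT.
apply: (IH _ _ (rcons p u)) => //.
- by apply: leq_trans (proper_card uRp) _; arith.
- by case: (p).
- move=> v a; rewrite mem_rcons inE => vp /awayP[aR ua].
  by case/predU1P: vp => [->//|/(mem_prefix pq)/q_far->].
- move=> a z /awayP[aR ua] zR az; have [zR'|zR'] := boolP (z \in R).
    by rewrite /= /legal_move edge_sym (away_boundary uR zR' zR) orbT.
  by rewrite /= has_cat (ends_guards a z) // !orbT.
- move=> a z /awayP[aR ua] zR az; rewrite has_rcons.
  have [zR'|zR'] := boolP (z \in R); first by rewrite (away_boundary uR zR' zR).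
  by rewrite (B_adj _ (BP a z aR zR' az)) orbT.
(* The initial end of the new path needs no new cop but [u], since [p] is a prefix of [q]. *)
- have take_p : {subset take n p <= take n q}.
    case/prefixP: pq => s -> v; rewrite take_cat; case: ltnP => // _ /mem_take.
    by rewrite mem_cat => ->.
  move=> v; rewrite /ends in_cons !mem_cat size_rcons => /orP[|].
    rewrite -cats1 take_cat; case: ltnP => [_ /take_p vq|/take_oversize pE].
      by rewrite vq !orbT.
    rewrite mem_cat => /orP[vp|/mem_take]; last by rewrite inE => ->.
    by rewrite take_p ?pE // !orbT.
  rewrite drop_rcons; last by arith.
  have -> : (size p).+1 - n = size p - n.-1 by arith.
  by rewrite mem_rcons in_cons -/T => /orP[->//|->]; rewrite orbT.
- by rewrite /= size_cat; arith.
Qed.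

(** * The opening position *)

Theorem theorem10 (n : nat) (n_gt0 : 0 < n) (G : sgraph)
    (G_conn : connected G)
    (G_free : free_of (fun H : sgraph => H = claw n \/ H = net n) G) :
  cop_number G <= 4 * n.
Proof.
rewrite /cop_number; case: ex_minnP => k _ k_min.
have [G0|[v _]] := set_0Vmem [set: G].
  have noG (x : G) : False by have := in_setT x; rewrite G0 inE.
  (* In the empty graph the robber has no walk, so zero cops win vacuously. *)
  apply: (leq_trans (k_min 0 _)) => //; apply/asboolP.
  exists (fun=> [ffun i : 'I_0 => match notF (ltn_ord i) with end]).
    by move=> h x [].
  by move=> s; case: (noG (s 0)).
apply/k_min/asboolP.
(* All cops start at [v]; the one-vertex path there starts the induction, as every exit of [away
   [set: G] v] is adjacent to [v]. *)
apply: (@cops_win_win _ _ [ffun=> v]) => x.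
have i0 : 'I_(4 * n) by apply: (@Ordinal _ 0); lia.
have [vx|nvx] := boolP (legal_move v x).
  by apply: (win_capture (i := i0)); rewrite ffunE.
have bnd a z : a \in away [set: G] v -> z \notin away [set: G] v ->
    edge a z -> edge z v.
  move=> /awayP[_ va] zv az; move: zv; rewrite !inE /= negbK.
  case/predU1P=> [vz|]; last by rewrite edge_sym.
  by rewrite vz /legal_move edge_sym az orbT in va.
apply: (wins_on_ends n_gt0 G_conn G_free (R := away [set: G] v) (q := [:: v])
  (E := [:: v])) => //.
- by split=> // w [] // [] // _ _; rewrite /= edge_irr consecutive_irr.
- by move=> w a; rewrite inE => /eqP-> /awayP[].
- by move=> a z aR zR az; rewrite /= /legal_move edge_sym (bnd a z) // orbT.
- by move=> a z aR zR az; rewrite /= (bnd a z).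
- by move=> w; rewrite mem_cat => /orP[/mem_take|/mem_drop].
- by rewrite /=; lia.
- by move=> w; rewrite inE => /eqP->; apply/codomP; exists i0; rewrite ffunE.
- by rewrite !inE.
Qed.
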